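(* Let $\delta$ be the unique zero in $(1/9,1/6)$ of the polynomial $P(d)=1-7d+3d^2+4d^3-2d^4-d^5$. For every real $d$ with $\delta<d\le 1/6$, there is a set of directions $\mathrm{IP}(d)\subset[0,\pi)$ of positive Lebesgue measure such that for almost every $\theta\in \mathrm{IP}(d)$ (with respect to Lebesgue measure), $$\mathcal{H}^{s_d}\big(p_\theta(\mathcal{C}(d))\big)=0.$$
   Context: For $0<d\le 1/4$, let $K_d=(1-d)\{\sum_{n=0}^\infty a_n d^n : a_n\in\{0,1\}\}\subset\mathbb{R}$ and let $\mathcal{C}(d)=K_d\times K_d\subset\mathbb{R}^2$ be the four-corner Cantor set, whose Hausdorff dimension is $s_d=\log 4/\log(1/d)$. For $\theta\in[0,\pi)$, $p_\theta:\mathbb{R}^2\to\mathbb{R}$ is the projection $p_\theta(x,y)=x\cos\theta+y\sin\theta$. $\mathcal{H}^s$ denotes $s$-dimensional Hausdorff measure. Numerically $\delta=0.155124983896014\ldots$. *)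

(* Defs.v *)
From HB Require Import structures.
From mathcomp Require Import all_boot all_order all_algebra.
From mathcomp Require Import all_classical all_reals all_analysis.

Set Implicit Arguments.
Unset Strict Implicit.
Unset Printing Implicit Defensive.

Import Order.TTheory GRing.Theory Num.Theory.
Import numFieldNormedType.Exports.

Local Open Scope classical_set_scope.
Local Open Scope ring_scope.

Section hausdorff_measure.
Context {R : realType} {V : normedModType R}.
Implicit Types (A U : set V) (s e : R).
Local Open Scope ereal_scope.

(* 0 is adjoined so that the diameter of the empty set is 0, not -oo. *)
Definition diameter U : \bar R :=
  ereal_sup (0 |` [set `|p.1 - p.2|%:E | p in U `*` U]).

(* The empty set has gauge 0 also for s = 0, where 0 `^ 0 = 1; thus the
   measure for s = 0 is the counting measure, and countable covers include
   finite ones. *)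
Definition hausdorff_gauge s U : \bar R :=
  if U == set0 then 0 else poweR (diameter U) s.

Definition hausdorff_content s e A : \bar R :=
  ereal_inf [set \sum_(0 <= i <oo) hausdorff_gauge s (U i)
            | U in [set U : nat -> set V | A `<=` \bigcup_i U i
                                   /\ forall i, diameter (U i) <= e%:E]].

(* No normalizing constant. *)
Definition hausdorff_measure s A : \bar R :=
  ereal_sup [set hausdorff_content s e A | e in [set e : R | (0 < e)%R]].

End hausdorff_measure.

Section four_corner.
Context {R : realType}.
Implicit Types d theta : R.

Definition cantor_K d : set R :=
  [set (1 - d) * limn [series (a n)%:R * d ^+ n]_n
  | a in [set: nat -> bool]].

Definition four_corner d : set (R * R) := cantor_K d `*` cantor_K d.

Definition four_corner_dim d : R := ln 4 / ln (1 / d).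

Definition proj_dir theta (p : R * R) : R :=
  p.1 * cos theta + p.2 * sin theta.

Definition P_delta : {poly R} :=
  1 - 7 *: 'X + 3 *: 'X^2 + 4 *: 'X^3 - 2 *: 'X^4 - 'X^5.

End four_corner.

(* Main.v *)
Require Import Defs.
From HB Require Import structures.
From mathcomp Require Import all_boot all_order all_algebra.
From mathcomp Require Import all_classical all_reals all_analysis.
From mathcomp Require Import ring lra.

Import Order.TTheory GRing.Theory Num.Theory.
Import numFieldNormedType.Exports.

Local Open Scope classical_set_scope.
Local Open Scope ring_scope.

(**
Write [C] for the four-corner set and call a direction [theta] an overlap
direction when two distinct points of [C] have the same projection.

Near an overlap direction there are, for every [eps] and at every small scale
[d ^ n], a proportion at least [kappa(eps)] of directions for which two distinct
level-[n] pieces of the projection are [eps d ^ n]-close to being equal: the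
distance of the two pieces is a sinusoid in [theta] with a nearby simple zero.
So, for fixed [eps], the overlap directions without such a pair form a porous
set, which is null by Lebesgue's density theorem.  Once such pairs exist for
every [eps], a cover of the projection may be used for two pieces at once, and
the [s_d]-dimensional content satisfies [m <= (1 - 2 / N) m + (m + o(1)) / N],
hence [m = 0].

It remains to find an interval of overlap directions.  For the slope [l] this
amounts to expanding [0] as a nontrivial sum of [(a_i - l b_i) d ^ i] with
[a_i, b_i] in [{-1, 0, 1}].  Starting from the digit [-(1 - l)], the remainder is
followed under [z |-> (z - (a - l b) (1 - d)) / d]; it has to be steered into
[[-1, 1]], and [[-1, 1]] has to be mapped into itself by suitable digits.  The
nine images of [[-1, 1]] leave two opposite holes in [[-1, 1]], whose points
come back to [[-1, 1]] in three steps when the width lies in a suitable window,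
which is possible for slopes near [1 - 2d] exactly down to the root of
[P_delta].
*)

Set Implicit Arguments.
Unset Strict Implicit.
Unset Printing Implicit Defensive.

(** * Expansions with overlapping digits *)

Section expansions.
Variable R : realFieldType.
Implicit Types (l d z v : R) (p q : bool * bool).

(** With [l = tan (theta - pi / 2)] this is the projection of the corner [p] in direction [theta],
    divided by [cos (theta - pi / 2)]. *)
Definition slice l p : R := p.2%:R - l * p.1%:R.

(* [z] is steered into [[-1, 1]] by finitely many digits, along remainders that
   stay in [[-2, 2]]. *)
Inductive expandable l d z : Prop :=
| expandable1 of `|z| <= 1
| expandableS p q of `|z| <= 2 &
    expandable l d ((z - (slice l p - slice l q) * (1 - d)) / d).

Lemma expandableN l d z : expandable l d z -> expandable l d (- z).
Proof.
elim=> {}z; first by move=> z1; apply: expandable1; rewrite normrN.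
move=> p q z2 _ IH; apply: (@expandableS _ _ _ q p); first by rewrite normrN.
by move: IH; congr expandable; rewrite -mulNr; congr (_ / _); ring.
Qed.

Lemma expandable_digit1 l d z : `|z| <= 2 ->
  expandable l d ((z - (1 - d)) / d) -> expandable l d z.
Proof.
move=> z2 e; apply: (@expandableS _ _ _ (false, true) (false, false)) => //.
by rewrite /slice/= mulr0 !subr0 mul1r.
Qed.

Lemma expandable_digit1D l d z : `|z| <= 2 ->
  expandable l d ((z - (1 + l) * (1 - d)) / d) -> expandable l d z.
Proof.
move=> z2 e; apply: (@expandableS _ _ _ (false, true) (true, false)) => //.
by rewrite /slice/= mulr0 mulr1 !subr0 sub0r opprK.
Qed.

(** [1 + l] is the fixed point of the digit [1 + l], so each use of this digit divides the distance
    to it by [d]. *)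
Lemma expandable_top l d k (u : R) : 0 < d -> d <= 1 / 6 -> 0 < l < 1 ->
  0 <= u -> u <= 3 -> expandable l d (1 + l - u) ->
  expandable l d (1 + l - d ^+ k * u).
Proof.
move=> d0 d6 /andP[l0 l1] u0 u2 e; elim: k => [|k IH]; first by rewrite expr0 mul1r.
have d1 : d <= 1 by lra.
have dk : d ^+ k.+1 <= 1 by apply: exprn_ile1 => //; exact: ltW.
have dk1 : d ^+ k.+1 * u <= 3 by rewrite (le_trans _ u2)// ler_piMl.
have dk0 : 0 <= d ^+ k.+1 * u by rewrite mulr_ge0// exprn_ge0// ltW.
apply: expandable_digit1D; first by rewrite ler_norml; apply/andP; split; lra.
move: IH; congr expandable; rewrite exprS; field; lra.
Qed.

(** The digit [1] leads to [1 + w], which the digit [1 + l] sends into [[-1, 1]] exactly under the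
    two bounds on [w]. *)
Lemma expandable_tail l d (w : R) : 0 < d -> d <= 1 / 6 -> 6 / 10 < l < 1 ->
  l * (1 - d) - 2 * d <= w -> w <= l * (1 - d) -> expandable l d (1 + d * w).
Proof.
move=> d0 d6 /andP[l0 l1] w1 w2.
have w0 : 0 <= w by nra.
have w3 : w <= 1 by nra.
have dw0 : 0 <= d * w by rewrite mulr_ge0// ltW.
have dw1 : d * w <= 1 by rewrite mulr_ile1//; lra.
apply: expandable_digit1; first by rewrite ler_norml; apply/andP; split; lra.
rewrite (_ : _ / d = 1 + w); last by field; lra.
apply: expandable_digit1D; first by rewrite ler_norml; apply/andP; split; lra.
apply: expandable1; rewrite ler_norml ler_pdivrMr// ler_pdivlMr//.
by apply/andP; split; lra.
Qed.

(* The width of the gap between the images of [[-1, 1]] for the digits [1 - l] and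
   [l]. *)
Definition hole l d : R := (2 * l - 1) * (1 - d) - 2 * d.

(* The bounds on [hole l d] say that a point [1 + v] with [v] between [hole / 2d]
   and [hole / d], reached from the hole, goes back to [[-1, 1]] with the digits
   [1] and [1 + l]. *)
Definition window l d : Prop :=
  [/\ 6 / 10 < l < 1, (1 - l) * (1 - d) <= 2 * d & hole l d <= 0 \/
    2 * d ^+ 2 * (l * (1 - d) - 2 * d) <= hole l d <= d ^+ 2 * (l * (1 - d))].

Lemma expandable_hole l d v : 0 < d -> d <= 1 / 6 -> window l d ->
  hole l d / 2 <= d * v -> d * v <= hole l d -> 0 < hole l d ->
  expandable l d (1 + v).
Proof.
move=> d0 d6 [l01 _] + v1 v2 h0; case=> [|/andP[h1 h2]]; first lra.
rewrite (_ : v = d * (v / d)); last by field; lra.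
have vd : v = d * (v / d) by field; lra.
have d20 : 0 < d ^+ 2 by rewrite exprn_gt0.
apply: expandable_tail => //.
  by rewrite -(ler_pM2l d20) [leRHS](_ : _ = d * v); [lra|field; lra].
by rewrite -(ler_pM2l d20) [leLHS](_ : _ = d * v); [lra|field; lra].
Qed.

(** The images of [[-1, 1]] for the digits [0], [1 - l], [l], [1] have half-width [d]. The condition
    [(1 - l) (1 - d) <= 2 d] closes the first and the last gap, so only the middle one can be a
    hole. *)
Lemma expandable_unit_step l d z : 0 < d -> d <= 1 / 6 -> window l d ->
  0 <= z <= 1 ->
  exists p q, expandable l d ((z - (slice l p - slice l q) * (1 - d)) / d).
Proof.
move=> d0 d6 win /andP[z0 z1]; have [/andP[l0 l1] small_steps _] := win.
have [zd|zd] := leP z d.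
  exists (false, false), (false, false); apply: expandable1.
  rewrite subrr mul0r subr0 ler_norml ler_pdivrMr// ler_pdivlMr//.
  by apply/andP; split; lra.
have [zB|zB] := leP z ((1 - l) * (1 - d) + d).
  exists (true, true), (false, false); apply: expandable1.
  rewrite /slice/= mulr1 mulr0 !subr0 ler_norml ler_pdivrMr// ler_pdivlMr//.
  by apply/andP; split; lra.
have [zl|zl] := leP (l * (1 - d) + d) z.
  exists (false, true), (false, false); apply: expandable1.
  rewrite /slice/= mulr0 !subr0 mul1r ler_norml ler_pdivrMr// ler_pdivlMr//.
  by apply/andP; split; lra.
have [zh|zh] := leP (l * (1 - d) - d) z.
  exists (false, false), (true, false); apply: expandable1.
  rewrite /slice/= mulr1 mulr0 !sub0r oppr0 opprK add0r.
  by rewrite ler_norml ler_pdivrMr// ler_pdivlMr//; apply/andP; split; lra.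
have h0 : 0 < hole l d by rewrite /hole; lra.
(* In the hole the digit of the farther image is taken, so that the overshoot [v] satisfies
   [hole / 2 <= d v <= hole]. *)
have [zm|zm] := leP (z - (1 - l) * (1 - d) - d) (hole l d / 2).
  exists (false, false), (true, false).
  rewrite /slice/= mulr1 mulr0 !sub0r oppr0 opprK add0r.
  rewrite (_ : _ / d = - (1 + (l * (1 - d) - d - z) / d)); last by field; lra.
  apply/expandableN/expandable_hole => //; rewrite [d * _]mulrC divfK ?gt_eqF//.
    by rewrite /hole in zm *; lra.
  by rewrite /hole; lra.
exists (true, true), (false, false).
rewrite /slice/= mulr1 mulr0 !subr0.
rewrite (_ : _ / d = 1 + (z - (1 - l) * (1 - d) - d) / d); last by field; lra.
apply/expandable_hole => //; rewrite [d * _]mulrC divfK ?gt_eqF//; first lra.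
by rewrite /hole; lra.
Qed.

(** This makes the finite steering endless: also from [[-1, 1]] some digit leads to an expandable
    remainder. *)
Lemma expandable_step l d z : 0 < d -> d <= 1 / 6 -> window l d ->
  expandable l d z -> `|z| <= 2 /\
  exists p q, expandable l d ((z - (slice l p - slice l q) * (1 - d)) / d).
Proof.
move=> d0 d6 win [z1|p q z2 e]; last by split => //; exists p, q.
split; first lra.
have [z0|z0] := leP 0 z.
  by apply: expandable_unit_step => //; rewrite z0 -(ger0_norm z0).
have [//|//|//||p [q e]] := @expandable_unit_step l d (- z).
  by rewrite -(ltr0_norm z0) normr_ge0.
exists q, p; rewrite -[X in expandable _ _ X]opprK.
by apply: expandableN; move: e; congr expandable; field; lra.
Qed.

Lemma expandable_words l d n z : 0 < d -> d <= 1 / 6 -> window l d ->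
  expandable l d z ->
  exists u w : nat -> bool * bool,
   `|z - (1 - d) * \sum_(i < n) (slice l (u i) - slice l (w i)) * d ^+ i| <= 2 * d ^+ n.
Proof.
move=> d0 d6 win; elim: n z => [|n IH] z /(expandable_step d0 d6 win)[z2 [p [q e]]].
  by exists (fun=> p), (fun=> q); rewrite big_ord0 mulr0 subr0 expr0 mulr1.
have [u [w uw]] := IH _ e.
exists (fun i => if i is j.+1 then u j else p), (fun i => if i is j.+1 then w j else q).
rewrite big_ord_recl/= expr0 mulr1.
under eq_bigr => i _ do rewrite /= exprS mulrCA.
rewrite -mulr_sumr exprS mulrCA -[leLHS](_ : d * `|(z - (slice l p - slice l q) * (1 - d)) / d -
           (1 - d) * \sum_(i < n) (slice l (u i) - slice l (w i)) * d ^+ i| = _).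
  by rewrite ler_pM2l.
rewrite -{1}(gtr0_norm d0) -normrM; congr `| _ |.
by field; rewrite gt_eqF.
Qed.

(** The starting remainder is [1 + l - (l - (1 - 2 d)) / d]; at the slope [1 - 2 d] it is the fixed
    point [1 + l]. *)
Lemma expandable_start l d k (u : R) : 0 < d -> d <= 1 / 6 -> 0 < l < 1 ->
  0 <= u -> u <= 3 -> expandable l d (1 + l - u) ->
  l = 1 - 2 * d + d ^+ k.+1 * u -> expandable l d ((1 - l) * (1 - d) / d).
Proof.
move=> d0 d6 l01 u0 u3 e lE; move: (expandable_top k d0 d6 l01 u0 u3 e).
congr expandable; rewrite (_ : d ^+ k * u = (l - (1 - 2 * d)) / d).
  by field; lra.
by rewrite lE exprS; field; lra.
Qed.

Lemma expandable_start_digit1 l d k (t : R) : 0 < d -> d <= 1 / 6 ->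
  0 < l < 1 -> l <= t -> t <= 2 ->
  l * (1 - d ^+ 3 + d ^+ 4) = 1 - 2 * d + d ^+ (k + 4) * t ->
  expandable l d ((1 - l) * (1 - d) / d).
Proof.
move=> d0 d6 /[dup] l01 /andP[l0 l1] tl t2 lE.
have dk1 : d ^+ k.+1 * t <= 2.
  have d1 : d <= 1 by lra.
  have dk : d ^+ k.+1 <= 1 by apply: exprn_ile1 => //; exact: ltW.
  by rewrite (le_trans _ t2)// ler_piMl//; lra.
have dk0 : 0 <= d ^+ k.+1 * t by rewrite mulr_ge0 ?exprn_ge0 ?ltW//; lra.
have dl0 : 0 <= l * d by rewrite mulr_ge0 ?ltW.
have dl1 : l * d <= l by rewrite ler_piMr ?ltW//; lra.
(* This [u] is chosen so that the digit [1] carries [1 + l - u] to [1 + l - d ^+ k * t], again close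
   to the fixed point. *)
apply: (@expandable_start l d 2 (l * (1 - d) + d ^+ k.+1 * t)) => //; [lra|lra| |].
  apply: expandable_digit1.
    by rewrite ler_norml; apply/andP; split; lra.
  rewrite (_ : _ / d = 1 + l - d ^+ k * t); last by rewrite exprS; field; lra.
  apply: expandable_top => //; [lra|lra|apply: expandable1].
  by rewrite ler_norml; apply/andP; split; lra.
rewrite exprSr; move: lE; rewrite exprD !exprS expr0 !mulr1; lra.
Qed.

(* [(1 - l) (1 - d) / d] is the remainder of [0] after the digit [-(1 - l)]. *)
Definition good_slopes d : Prop := exists l1 l2 : R,
  0 <= l1 /\ l1 < l2 /\ forall l, l1 < l < l2 ->
  window l d /\ expandable l d ((1 - l) * (1 - d) / d).

(* Here there is no hole: [hole l d <= 0] as soon as [l] is close to [1 - 2d]. *)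
Lemma good_slopes_nohole d : 11 / 70 <= d <= 1 / 6 -> good_slopes d.
Proof.
move=> /andP[d1 d2].
have d0 : 0 < d by lra.
have d50 : 0 < d ^+ 5 by rewrite exprn_gt0.
have d51 : d ^+ 5 <= (1 / 6) ^+ 5 by apply: lerXn2r; rewrite ?nnegrE; lra.
(* After four digits [1 + l] the remainder is [1 + l - u] with [u] in [[1, 2]]. At [l = 1 - 2 d] the
   hole has width [1 - 7 d + 4 d ^ 2], negative from just below [11 / 70] on. *)
exists (1 - 2 * d + d ^+ 5), (1 - 2 * d + 2 * d ^+ 5); split; first lra.
split; first lra.
move=> l /andP[l1 l2].
split.
  split; first by apply/andP; split; lra.
    by nra.
  by left; rewrite /hole; nra.
apply: (@expandable_start l d 4 ((l - (1 - 2 * d)) / d ^+ 5)) => //.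
- by apply/andP; split; lra.
- by rewrite divr_ge0; lra.
- by rewrite ler_pdivrMr//; lra.
- apply: expandable1; rewrite ler_norml lerBlDr.
  rewrite lerBrDr -lerBrDl ler_pdivrMr// -lerBlDl ler_pdivlMr//.
  by apply/andP; split; nra.
- by rewrite [_ ^+ _ * (_ / _)]mulrC divfK ?gt_eqF//; lra.
Qed.

(* The next polynomial inequalities hold on intervals so short that, after
   expanding at the left endpoint, the powers of the increment [e] can be treated
   as independent small quantities. *)
Lemma powers_small (e : R) n : 0 <= e -> e <= 1 / (20 * 20) ->
  0 <= e ^+ n.+1 <= e ^+ n / (20 * 20).
Proof.
move=> e0 e1; rewrite exprn_ge0//= exprSr ler_wpM2l ?exprn_ge0//; lra.
Qed.

(** The lower bound of [windowI] at the slope [L - w] of [good_slopes_window], times [2 - d ^ 2];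
    the term in [(1 / 10) ^+ 5] pays for [w]. *)
Lemma window_low_poly d : 25 / (7 * 23) <= d -> d <= 11 / 70 ->
  (1 + d - 4 * d ^+ 3) * (2 - d ^+ 2) + (1 / 10) ^+ 5 * 4 <= 2 * (1 + d) ^+ 2 * (1 - d).
Proof.
move=> d1 d2.
have [e dE] : exists e : R, d = 25 / (7 * 23) + e by exists (d - 25 / (7 * 23)); ring.
have e0 : 0 <= e by lra.
have e1 : e <= 1 / (20 * 20) by lra.
have /andP[? ?] := powers_small 1 e0 e1.
have /andP[? ?] := powers_small 2 e0 e1.
have /andP[? ?] := powers_small 3 e0 e1.
have /andP[? ?] := powers_small 4 e0 e1.
have /andP[? ?] := powers_small 5 e0 e1.
have /andP[? ?] := powers_small 6 e0 e1.
have /andP[? ?] := powers_small 7 e0 e1.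
rewrite dE; lra.
Qed.

Lemma window_start_low_poly d : 25 / (7 * 23) <= d -> d <= 11 / 70 ->
  (1 - 2 * d) * ((1 - d) * (2 - d ^+ 2)) + (1 / 10) ^+ 5 * 2 <=
    (1 + d) * (1 - d ^+ 3).
Proof.
move=> d1 d2.
have [e dE] : exists e : R, d = 25 / (7 * 23) + e by exists (d - 25 / (7 * 23)); ring.
have e0 : 0 <= e by lra.
have e1 : e <= 1 / (20 * 20) by lra.
have /andP[? ?] := powers_small 1 e0 e1.
have /andP[? ?] := powers_small 2 e0 e1.
have /andP[? ?] := powers_small 3 e0 e1.
have /andP[? ?] := powers_small 4 e0 e1.
have /andP[? ?] := powers_small 5 e0 e1.
have /andP[? ?] := powers_small 6 e0 e1.
have /andP[? ?] := powers_small 7 e0 e1.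
rewrite dE; lra.
Qed.

Lemma window_start_high_poly d : 25 / (7 * 23) <= d -> d <= 11 / 70 ->
  1 + d <= (1 - 2 * d + 5 / 2 * d ^+ 3) * ((1 - d) * (2 - d ^+ 2)).
Proof.
move=> d1 d2.
have [e dE] : exists e : R, d = 25 / (7 * 23) + e by exists (d - 25 / (7 * 23)); ring.
have e0 : 0 <= e by lra.
have e1 : e <= 1 / (20 * 20) by lra.
have /andP[? ?] := powers_small 1 e0 e1.
have /andP[? ?] := powers_small 2 e0 e1.
have /andP[? ?] := powers_small 3 e0 e1.
have /andP[? ?] := powers_small 4 e0 e1.
have /andP[? ?] := powers_small 5 e0 e1.
have /andP[? ?] := powers_small 6 e0 e1.
have /andP[? ?] := powers_small 7 e0 e1.
rewrite dE; lra.
Qed.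

Lemma window_slope_low_poly d : 25 / (7 * 23) <= d -> d <= 11 / 70 ->
  (2 / 3 + (1 / 10) ^+ 5) * ((1 - d) * (2 - d ^+ 2)) <= 1 + d.
Proof.
move=> d1 d2.
have [e dE] : exists e : R, d = 25 / (7 * 23) + e by exists (d - 25 / (7 * 23)); ring.
have e0 : 0 <= e by lra.
have e1 : e <= 1 / (20 * 20) by lra.
have /andP[? ?] := powers_small 1 e0 e1.
have /andP[? ?] := powers_small 2 e0 e1.
have /andP[? ?] := powers_small 3 e0 e1.
have /andP[? ?] := powers_small 4 e0 e1.
have /andP[? ?] := powers_small 5 e0 e1.
have /andP[? ?] := powers_small 6 e0 e1.
have /andP[? ?] := powers_small 7 e0 e1.
rewrite dE; lra.
Qed.

Lemma window_slope_high_poly d : 25 / (7 * 23) <= d -> d <= 11 / 70 ->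
  1 + d <= 7 / 10 * ((1 - d) * (2 - d ^+ 2)).
Proof.
move=> d1 d2.
have [e dE] : exists e : R, d = 25 / (7 * 23) + e by exists (d - 25 / (7 * 23)); ring.
have e0 : 0 <= e by lra.
have e1 : e <= 1 / (20 * 20) by lra.
have /andP[? ?] := powers_small 1 e0 e1.
have /andP[? ?] := powers_small 2 e0 e1.
have /andP[? ?] := powers_small 3 e0 e1.
have /andP[? ?] := powers_small 4 e0 e1.
have /andP[? ?] := powers_small 5 e0 e1.
have /andP[? ?] := powers_small 6 e0 e1.
have /andP[? ?] := powers_small 7 e0 e1.
rewrite dE; lra.
Qed.

(** The lower bound of [windowI] at the limit slope [(1 - 2 d) / (1 - d ^ 3 + d ^ 4)]. *)
Lemma digit1_low_poly d : 11 / 71 <= d -> d <= 34 / (3 * 73) ->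
  (1 + d - 4 * d ^+ 3) * (1 - d ^+ 3 + d ^+ 4) <=
    2 * (1 - 2 * d) * (1 - d) ^+ 2 * (1 + d).
Proof.
move=> d1 d2.
have [e dE] : exists e : R, d = 11 / 71 + e by exists (d - 11 / 71); ring.
have e0 : 0 <= e by lra.
have e1 : e <= 1 / (20 * 20) by lra.
have /andP[? ?] := powers_small 1 e0 e1.
have /andP[? ?] := powers_small 2 e0 e1.
have /andP[? ?] := powers_small 3 e0 e1.
have /andP[? ?] := powers_small 4 e0 e1.
have /andP[? ?] := powers_small 5 e0 e1.
have /andP[? ?] := powers_small 6 e0 e1.
have /andP[? ?] := powers_small 7 e0 e1.
rewrite dE; lra.
Qed.

Lemma digit1_low_poly_level1 d : 34 / (3 * 73) <= d -> d <= 25 / (7 * 23) ->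
  (1 + d - 4 * d ^+ 3) * (1 - d ^+ 3 + d ^+ 4) <=
    2 * (1 - 2 * d + d ^+ 5 * (19 / 10)) * (1 - d) ^+ 2 * (1 + d).
Proof.
move=> d1 d2.
have [e dE] : exists e : R, d = 34 / (3 * 73) + e by exists (d - 34 / (3 * 73)); ring.
have e0 : 0 <= e by lra.
have e1 : e <= 1 / (20 * 20) by lra.
have /andP[? ?] := powers_small 1 e0 e1.
have /andP[? ?] := powers_small 2 e0 e1.
have /andP[? ?] := powers_small 3 e0 e1.
have /andP[? ?] := powers_small 4 e0 e1.
have /andP[? ?] := powers_small 5 e0 e1.
have /andP[? ?] := powers_small 6 e0 e1.
have /andP[? ?] := powers_small 7 e0 e1.
rewrite dE; lra.
Qed.

Lemma digit1_high_poly_level1 d : 34 / (3 * 73) <= d -> d <= 25 / (7 * 23) ->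
  (1 - 2 * d + d ^+ 5 * 2) * (1 - d) * (2 - d ^+ 2) <=
    (1 + d) * (1 - d ^+ 3 + d ^+ 4).
Proof.
move=> d1 d2.
have [e dE] : exists e : R, d = 34 / (3 * 73) + e by exists (d - 34 / (3 * 73)); ring.
have e0 : 0 <= e by lra.
have e1 : e <= 1 / (20 * 20) by lra.
have /andP[? ?] := powers_small 1 e0 e1.
have /andP[? ?] := powers_small 2 e0 e1.
have /andP[? ?] := powers_small 3 e0 e1.
have /andP[? ?] := powers_small 4 e0 e1.
have /andP[? ?] := powers_small 5 e0 e1.
have /andP[? ?] := powers_small 6 e0 e1.
have /andP[? ?] := powers_small 7 e0 e1.
rewrite dE; lra.
Qed.

(** The last two hypotheses are the bounds on [hole l d], with the terms in [l] collected on one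
    side. *)
Lemma windowI l d : 1 / 7 < d -> d <= 1 / 6 -> 2 / 3 < l < 1 ->
  1 + d - 4 * d ^+ 3 <= 2 * l * (1 - d) ^+ 2 * (1 + d) ->
  l * (1 - d) * (2 - d ^+ 2) <= 1 + d -> window l d.
Proof.
move=> d1 d2 /andP[l0 l1] h1 h2; split; [by apply/andP; split; lra|nra|right].
by rewrite /hole; apply/andP; split; lra.
Qed.

(* The slopes just below [L], the largest one in the window. *)
Lemma good_slopes_window d : 25 / (7 * 23) <= d <= 11 / 70 -> good_slopes d.
Proof.
move=> /andP[d1 d2].
have d0 : 0 < d by lra.
have d30 : 0 < d ^+ 3 by rewrite exprn_gt0.
pose D : R := (1 - d) * (2 - d ^+ 2).
have D0 : 0 < D by rewrite /D mulr_gt0; nra.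
pose w : R := (1 / 10) ^+ 5.
have [L LE] : exists L : R, L * D = 1 + d.
  by exists ((1 + d) / D); rewrite divfK ?gt_eqF.
have w0 : 0 < w by rewrite /w; lra.
have w1 : w <= 1 / 100 by rewrite /w; lra.
have L1 : 2 / 3 <= L - w.
  by rewrite lerBrDr -(ler_pM2r D0) LE; exact: window_slope_low_poly.
have L2 : L - w <= 7 / 10.
  have : L <= 7 / 10 by rewrite -(ler_pM2r D0) LE; exact: window_slope_high_poly.
  lra.
have d21 : 0 <= d ^+ 2 <= 1 by apply/andP; split; nra.
have lo1 : 1 + d - 4 * d ^+ 3 <= 2 * (L - w) * (1 - d) ^+ 2 * (1 + d).
  have d22 : 0 < 2 - d ^+ 2 by lra.
  rewrite -(ler_pM2r d22).
  rewrite [leRHS](_ : _ = 2 * (L * D - w * D) * ((1 - d) * (1 + d))); last by rewrite /D; ring.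
  have : w * (D * ((1 - d) * (1 + d))) <= w * 2.
    by rewrite ler_wpM2l ?(ltW w0)// /D; nra.
  by have := window_low_poly d1 d2; rewrite -/w LE; lra.
have lo2 : 1 - 2 * d <= (L - w) * (1 - d ^+ 3).
  rewrite -(ler_pM2r D0).
  rewrite [leRHS](_ : _ = (L * D - w * D) * (1 - d ^+ 3)); last by ring.
  have : w * (D * (1 - d ^+ 3)) <= w * 2.
    by rewrite ler_wpM2l ?(ltW w0)// /D; nra.
  by have := window_start_low_poly d1 d2; rewrite -/D -/w LE; lra.
have hi : (L - w) + w <= 1 - 2 * d + 5 / 2 * d ^+ 3.
  by rewrite subrK -(ler_pM2r D0) LE; exact: window_start_high_poly.
clearbody w.
exists (L - w), L; split; first lra.
split; first lra.
move=> l /andP[l1 l2].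
split.
  apply: windowI; [lra|lra|by apply/andP; split; lra| |].
    have e : 0 <= (1 - d) ^+ 2 * (1 + d) by rewrite mulr_ge0 ?sqr_ge0//; lra.
    have : (L - w) * ((1 - d) ^+ 2 * (1 + d)) <=
       l * ((1 - d) ^+ 2 * (1 + d)) by apply: ler_wpM2r => //; exact: ltW.
    lra.
  by rewrite -LE -mulrA ler_pM2r// ltW.
have ld : (L - w) * (1 - d ^+ 3) <= l * (1 - d ^+ 3).
  apply: ler_wpM2r; last exact: ltW.
  have d11 : d <= 1 by lra.
  have : d ^+ 3 <= 1 by apply: exprn_ile1 => //; exact: ltW.
  lra.
have ldl : 0 <= d ^+ 3 * (l - 2 / 3) by rewrite mulr_ge0 ?(ltW d30)//; lra.
have ldr : 0 <= d ^+ 3 * (7 / 10 - l + w) by rewrite mulr_ge0 ?(ltW d30)//; lra.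
(* Two digits [1 + l] suffice: [u] lies between [l] (by [lo2]) and [5 / 2] (by [hi]), so [1 + l - u]
   is in [[-1, 1]]. *)
apply: (@expandable_start l d 2 ((l - (1 - 2 * d)) / d ^+ 3)) => //.
- lra.
- by apply/andP; split; lra.
- by rewrite divr_ge0//; lra.
- by rewrite ler_pdivrMr//; lra.
- apply: expandable1; rewrite ler_norml lerBlDr.
  rewrite lerBrDr -lerBrDl ler_pdivrMr// -lerBlDl ler_pdivlMr//.
  by apply/andP; split; lra.
- by rewrite [_ ^+ _ * (_ / _)]mulrC divfK ?gt_eqF//; lra.
Qed.

(* The remainder is steered to [1 + l - d ^ k t] with [t] in [[1, 2]], by the digits
   [1 + l] twice and [1] once; [k] is free, and as [k] grows [l] tends to
   [(1 - 2d) / (1 - d ^ 3 + d ^ 4)], which is below the upper end of the window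
   exactly when [P_delta.[d] < 0]. *)
Lemma good_slopes_digit1 d k (a : R) : 11 / 71 <= d <= 25 / (7 * 23) -> 1 <= a < 2 ->
  (1 + d - 4 * d ^+ 3) * (1 - d ^+ 3 + d ^+ 4) <=
    2 * (1 - 2 * d + d ^+ (k + 4) * a) * (1 - d) ^+ 2 * (1 + d) ->
  (1 - 2 * d + d ^+ (k + 4) * 2) * (1 - d) * (2 - d ^+ 2) <=
    (1 + d) * (1 - d ^+ 3 + d ^+ 4) ->
  good_slopes d.
Proof.
move=> /andP[d1 d2] /andP[a1 a2] h1 h2.
have d0 : 0 < d by lra.
have d34 : 0 <= d ^+ 3 - d ^+ 4 <= 1 / 100.
  have : 0 < d ^+ 3 by rewrite exprn_gt0.
  have : d ^+ 3 <= (25 / (7 * 23)) ^+ 3 by apply: lerXn2r; rewrite ?nnegrE; lra.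
  rewrite (exprS d 3) => ? ?; apply/andP; split; nra.
case/andP : d34 => d340 d341.
set q := 1 - d ^+ 3 + d ^+ 4 in h1 h2.
have q0 : 0 < q by rewrite /q; lra.
have dk0 : 0 < d ^+ (k + 4) by rewrite exprn_gt0.
have dk1 : d ^+ (k + 4) <= 1 / 100.
  rewrite exprD.
  have d11 : d <= 1 by lra.
  have dk : d ^+ k <= 1 by apply: exprn_ile1 => //; exact: ltW.
  have dk4 : d ^+ 4 <= (25 / (7 * 23)) ^+ 4 by apply: lerXn2r; rewrite ?nnegrE; lra.
  rewrite (@le_trans _ _ (d ^+ 4))//; last lra.
  by rewrite ler_piMl// exprn_ge0// ltW.
(* The slopes are [l = (1 - 2 d + d ^ (k + 4) t) / q] with [t] from [a] to [2]; [h1] is the lower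
   window bound at [t = a], [h2] the upper one at [t = 2]. *)
exists ((1 - 2 * d + d ^+ (k + 4) * a) / q), ((1 - 2 * d + d ^+ (k + 4) * 2) / q).
split; first by rewrite divr_ge0 ?(ltW q0)//; nra.
split; first by rewrite ltr_pM2r ?invr_gt0// ltrD2l ltr_pM2l.
move=> l /andP[]; rewrite ltr_pdivrMr// ltr_pdivlMr// => l1 l2.
have l01 : 0 < l < 1 by apply/andP; split; rewrite /q in l1 l2; nra.
have l6 : 2 / 3 < l by rewrite /q in l1 l2; nra.
case/andP: (l01) => l0 l_1.
split.
  apply: windowI => //; [lra|lra|by apply/andP; split| |].
    rewrite -(ler_pM2r q0) (le_trans h1)//.
    have e : 0 <= (1 - d) ^+ 2 * (1 + d) by rewrite mulr_ge0 ?sqr_ge0//; lra.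
    have : (1 - 2 * d + d ^+ (k + 4) * a) * ((1 - d) ^+ 2 * (1 + d)) <=
       l * q * ((1 - d) ^+ 2 * (1 + d)) by apply: ler_wpM2r => //; exact: ltW.
    lra.
  rewrite -(ler_pM2r q0) (le_trans _ h2)//.
  have e : 0 <= (1 - d) * (2 - d ^+ 2) by rewrite mulr_ge0//; nra.
  have : l * q * ((1 - d) * (2 - d ^+ 2)) <=
      (1 - 2 * d + d ^+ (k + 4) * 2) * ((1 - d) * (2 - d ^+ 2))
    by apply: ler_wpM2r => //; exact: ltW.
  lra.
apply: (@expandable_start_digit1 l d k ((l * q - (1 - 2 * d)) / d ^+ (k + 4))) => //.
- lra.
- by rewrite ler_pdivlMr//; nra.
- by rewrite ler_pdivrMr//; lra.
- by rewrite -/q [_ ^+ _ * (_ / _)]mulrC divfK ?gt_eqF//; lra.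
Qed.

(** As [d] decreases to the root, more digits are needed before [[-1, 1]] is reached. Over a general
    ordered field the smallness of the powers of [d] has to be assumed. *)
Lemma good_slopes_gt_delta d : 11 / 71 < d <= 1 / 6 ->
  (forall e : R, 0 < e -> exists k, d ^+ k <= e) ->
  1 - 7 * d + 3 * d ^+ 2 + 4 * d ^+ 3 - 2 * d ^+ 4 - d ^+ 5 < 0 ->
  good_slopes d.
Proof.
move=> /andP[d1 d2] archi Pneg.
have d0 : 0 < d by lra.
have [dC|dC] := leP (11 / 70) d.
  by apply: good_slopes_nohole; apply/andP.
have [dB|dB] := leP (25 / (7 * 23)) d.
  by apply: good_slopes_window; apply/andP; split; lra.
(* The lower bound on the hole fails at the limit slope before [d] reaches [25 / (7 * 23)]; level
   [k = 1] with [t] close to [2] raises the slope enough. *)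
have [dA|dA] := leP (34 / (3 * 73)) d.
  apply: (@good_slopes_digit1 d 1 (19 / 10)); [apply/andP; split; lra|lra| |].
    by apply: digit1_low_poly_level1; lra.
  by apply: digit1_high_poly_level1; lra.
set P := 1 - 7 * d + 3 * d ^+ 2 + 4 * d ^+ 3 - 2 * d ^+ 4 - d ^+ 5 in Pneg.
(* [P] equals [(1 - 2 d) (1 - d) (2 - d ^ 2) - (1 + d) (1 - d ^ 3 + d ^ 4)], the defect of the upper
   bound at the limit slope. The correction at level [k] is at most [4 d ^ k]. *)
have [|k dk] := archi (- P / 4); first lra.
rewrite /P in dk.
have d11 : d <= 1 by lra.
have d40 : 0 < d ^+ 4 by rewrite exprn_gt0.
have d41 : d ^+ 4 <= 1 by apply: exprn_ile1 => //; exact: ltW.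
have dk0 : 0 < d ^+ k by rewrite exprn_gt0.
apply: (@good_slopes_digit1 d k 1); [apply/andP; split; lra|lra| |].
  apply: (le_trans (digit1_low_poly _ _)); [lra|lra|].
  have dk4 : 0 <= d ^+ (k + 4) by rewrite exprn_ge0// ltW.
  have dd : 0 <= (1 - d) ^+ 2 * (1 + d) by rewrite mulr_ge0 ?sqr_ge0//; lra.
  by have := mulr_ge0 dk4 dd; lra.
have E : 0 <= (1 - d) * (2 - d ^+ 2) <= 2 by apply/andP; split; nra.
case/andP: E => E0 E1.
have : d ^+ (k + 4) * 2 * ((1 - d) * (2 - d ^+ 2)) <= d ^+ k * 2 * 2.
  rewrite ler_pM// ?mulr_ge0// ?exprn_ge0 ?(ltW d0)// ler_pM2r//.
  by rewrite exprD ler_piMr// ltW.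
lra.
Qed.

End expansions.

(** * Null Hausdorff measure from nearly equal pieces *)

Section interval_covers.
Variable R : realType.
Implicit Types (A : set R) (e s c : R) (L : seq (R * R)).

(* [(a, l)] encodes the interval [[a, a + l]]. *)
Definition covers e A L : Prop :=
  all (fun I : R * R => 0 < I.2 <= e) L /\
  A `<=` [set x | has (fun I : R * R => I.1 <= x <= I.1 + I.2) L].

Definition cost s L : R := \sum_(I <- L) I.2 `^ s.

Lemma cost_ge0 s L : 0 <= cost s L.
Proof. by apply: sumr_ge0 => I _; exact: powR_ge0. Qed.

Lemma diameter_le A (l : R) : 0 <= l ->
  (forall x y, A x -> A y -> `|x - y| <= l) -> (diameter A <= l%:E)%E.
Proof.
move=> l0 h; apply: ge_ereal_sup => _ [->|[[x y] [/= Ax Ay] <-]] /=.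
  by rewrite lee_fin.
by rewrite lee_fin; exact: h.
Qed.

Lemma diameter_ge0 A : (0 <= diameter A)%E.
Proof. by apply: ereal_sup_ubound; left. Qed.

Lemma hausdorff_gauge_ge0 s A : (0 <= hausdorff_gauge s A)%E.
Proof. by rewrite /hausdorff_gauge; case: ifP => // _; exact: poweR_ge0. Qed.

(** The finite list is completed to a sequence by empty sets, whose gauge is [0]. *)
Lemma hausdorff_content_le s e A L : 0 < s -> 0 < e -> covers e A L ->
  (hausdorff_content s e A <= (cost s L)%:E)%E.
Proof.
move=> s0 e0 [/allP Le AL].
pose U i : set R := if (i < size L)%N then
   [set x | (nth (0, 0) L i).1 <= x <= (nth (0, 0) L i).1 + (nth (0, 0) L i).2]
   else set0.
have dU i : (i < size L)%N -> (diameter (U i) <= (nth (0, 0) L i).2%:E)%E.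
  move=> iL; rewrite /U iL; apply: diameter_le.
    by have /andP[/ltW] := Le _ (mem_nth (0, 0) iL).
  move=> x y /= /andP[x1 x2] /andP[y1 y2].
  by rewrite ler_norml; apply/andP; split; lra.
have U0 i : (size L <= i)%N -> U i = set0 by rewrite /U leqNgt => /negbTE ->.
apply: (@le_trans _ _ (\sum_(0 <= i <oo) hausdorff_gauge s (U i))%E).
  apply: ereal_inf_lbound; exists U => //; split.
    move=> x /AL /= /hasP[I IL xI].
    exists (index I L) => //; rewrite /U index_mem IL/= nth_index//.
  move=> i; case: (ltnP i (size L)) => iL.
    rewrite (le_trans (dU _ iL))// lee_fin.
    by have /andP[] := Le _ (mem_nth (0, 0) iL).
  by rewrite U0//; apply: diameter_le => //; exact: ltW.
rewrite (nneseries_split 0 (size L)); last by move=> *; exact: hausdorff_gauge_ge0.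
rewrite add0n (@eseries0 _ _ (size L)) ?adde0; last first.
  by move=> i iL _; rewrite U0// /hausdorff_gauge eqxx.
rewrite /cost (big_nth (0, 0)) -sumEFin big_nat [leRHS]big_nat.
apply: lee_sum => i /andP[_ iL]; rewrite /hausdorff_gauge; case: ifP => _.
  by rewrite lee_fin powR_ge0.
rewrite -poweR_EFin; apply: gt0_ler_poweR; rewrite ?dU ?ltW//.
- by rewrite in_itv/= diameter_ge0 leey.
- rewrite in_itv/= leey andbT lee_fin.
  by have /andP[/ltW] := Le _ (mem_nth (0, 0) iL).
Qed.

Lemma hausdorff_measure_eq0 s A : 0 < s ->
  (forall e c, 0 < e -> 0 < c -> exists2 L, covers e A L & cost s L <= c) ->
  hausdorff_measure s A = 0%E.
Proof.
move=> s0 h; apply/eqP; rewrite eq_le; apply/andP; split.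
  apply: ge_ereal_sup => _ [e e0 <-]; apply/lee_addgt0Pr => c c0.
  have [L LA Lc] := h e c e0 c0.
  by rewrite add0e (le_trans (hausdorff_content_le s0 e0 LA))// lee_fin.
apply: (@le_trans _ _ (hausdorff_content s 1 A)).
  apply: le_ereal_inf_tmp => _ [U _ <-].
  by apply: nneseries_ge0 => *; exact: hausdorff_gauge_ge0.
by apply: ereal_sup_ubound; exists 1 => //=; exact: ltr01.
Qed.

Lemma covers_exists e A (M : R) : 0 < e -> A `<=` [set x | `|x| <= M] ->
  exists L, covers e A L.
Proof.
move=> e0 AM.
have [n nE] : exists n, n = (Num.truncn (2 * M / e)).+1 by eexists.
exists [seq (- M + e * k%:R, e) | k <- iota 0 n]; split.
  by apply/allP => _ /mapP[k _ ->]/=; rewrite e0 lexx.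
move=> x /AM /=; rewrite ler_norml => /andP[x1 x2].
have y0 : 0 <= (x + M) / e by rewrite divr_ge0 ?(ltW e0)//; lra.
have /andP[k1 k2] := truncn_itv y0.
apply/hasP; exists (- M + e * (Num.truncn ((x + M) / e))%:R, e).
  apply/mapP; exists (Num.truncn ((x + M) / e)) => //.
  rewrite mem_iota/= add0n nE ltnS; apply: le_truncn.
  by rewrite ler_pM2r ?invr_gt0//; lra.
move: k1 k2; rewrite ler_pdivlMr// ltr_pdivrMr// -natr1/=.
by move=> k1 k2; apply/andP; split; lra.
Qed.

Lemma min_length L (c : R) : 0 < c -> all (fun I : R * R => 0 < I.2) L ->
  exists2 eps : R, 0 < eps & all (fun I : R * R => eps <= c * I.2) L.
Proof.
move=> c0; elim: L => [_|I L IH /= /andP[I0 /IH[eps eps0 h]]]; first by exists 1.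
exists (Num.min eps (c * I.2)); first by rewrite lt_min eps0 mulr_gt0.
rewrite ge_min lexx orbT/=; apply: sub_all h => J /= h.
by rewrite ge_min h.
Qed.

Lemma cost_scale s (r : R) L : 0 <= r -> all (fun I : R * R => 0 < I.2) L ->
  \sum_(I <- L) (r * I.2) `^ s = r `^ s * cost s L.
Proof.
move=> r0 /allP L0; rewrite /cost mulr_sumr !big_seq; apply: eq_bigr => I IL.
by rewrite powRM// ltW// L0.
Qed.

Section pair_of_pieces.
Variables (I : finType) (t : I -> R) (i j : I) (r eps : R).

(** The pieces [i] and [j] share one copy of [L1], lengthened to absorb their offset. Each other
    piece gets its own copy of [L2], which may be chosen after the number of pieces is known. *)
Definition refine (L1 L2 : seq (R * R)) : seq (R * R) :=
  [seq (t k + r * J.1, r * J.2) | k <- enum [pred k | k != i & k != j], J <- L2] ++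
  [seq (Num.min (t i) (t j) + r * J.1, r * (J.2 + eps)) | J <- L1].

Lemma covers_refine e A L1 L2 : 0 < r -> r <= 1 -> 0 < eps ->
  A `<=` \bigcup_k [set t k + r * x | x in A] ->
  `|t i - t j| <= eps * r -> all (fun J : R * R => r * (J.2 + eps) <= e) L1 ->
  covers e A L1 -> covers e A L2 -> covers e A (refine L1 L2).
Proof.
move=> r0 r1 eps0 At tij /allP L1e [/allP L10 AL1] [/allP L20 AL2]; split.
  apply/allP => J; rewrite mem_cat => /orP[/allpairsP[[k J'] /= [_ J'L ->]]|].
    have /andP[J'0 J'e] /= := L20 _ J'L.
    by rewrite mulr_gt0//= (le_trans _ J'e)// ler_piMl// ltW.
  move=> /mapP[J' J'L ->]/=; rewrite L1e// andbT mulr_gt0// addr_gt0//.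
  by have /andP[] := L10 _ J'L.
move=> _ /At [k _ [x Ax <-]] /=; rewrite has_cat; apply/orP.
have [kij|] := boolP ((k == i) || (k == j)); last first.
  rewrite negb_or => kij; left.
  have /hasP[J JL /andP[xJ1 xJ2]] := AL2 _ Ax.
  apply/hasP; exists (t k + r * J.1, r * J.2).
    by apply: allpairs_f => //; rewrite mem_enum inE.
  rewrite /= lerD2l ler_pM2l// xJ1/= -addrA lerD2l -mulrDr ler_pM2l//.
right; have /hasP[J JL /andP[xJ1 xJ2]] := AL1 _ Ax.
apply/hasP; exists (Num.min (t i) (t j) + r * J.1, r * (J.2 + eps)).
  by apply/mapP; exists J.
have tk : Num.min (t i) (t j) <= t k <= Num.min (t i) (t j) + r * eps.
  move: tij; rewrite ler_norml => /andP[t1 t2]; rewrite minElt.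
  by case: ifP => tt; case/orP: kij => /eqP ->; apply/andP; split; lra.
have {}xJ1 : r * J.1 <= r * x by rewrite ler_pM2l.
have {}xJ2 : r * x <= r * (J.1 + J.2) by rewrite ler_pM2l.
by case/andP: tk => ? ? /=; apply/andP; split; lra.
Qed.

Lemma cost_refine s (b : R) L1 L2 : 0 < s -> 0 < r -> 0 < eps -> i != j -> 0 <= b ->
  all (fun J : R * R => 0 < J.2) L1 -> all (fun J : R * R => 0 < J.2) L2 ->
  all (fun J : R * R => J.2 + eps <= b * J.2) L1 ->
  cost s (refine L1 L2) <=
    r `^ s * ((#|I|%:R - 2) * cost s L2 + b `^ s * cost s L1).
Proof.
move=> s0 r0 eps0 ij b0 L10 L20 L1b.
rewrite {1}/cost /refine big_cat/= big_allpairs_dep big_map mulrDr; apply: lerD.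
  under eq_bigr do rewrite /= cost_scale ?(ltW r0)//.
  rewrite big_const_seq count_predT iter_addr_0 -cardE.
  have -> : #|[pred k | k != i & k != j]| = (#|I| - 2)%N.
    have := cardC (pred2 i j); rewrite card2 ij => <-.
    rewrite addKn; apply: eq_card => k; rewrite !inE negb_or//.
  rewrite -[leLHS]mulr_natl natrB; last first.
    by have := max_card (pred2 i j); rewrite card2 ij.
  by rewrite mulrCA.
rewrite (@le_trans _ _ (\sum_(J <- L1) (r * (b * J.2)) `^ s))//.
  rewrite big_seq [leRHS]big_seq; apply: ler_sum => J JL.
  have J0 : 0 < J.2 by exact: (allP L10).
  apply: ge0_ler_powR; rewrite ?nnegrE ?(ltW s0)//=.
  - by rewrite mulr_ge0 ?(ltW r0)// addr_ge0// ltW.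
  - by rewrite !mulr_ge0 ?(ltW r0)// ltW.
  - by rewrite ler_pM2l// (allP L1b).
under eq_bigr do rewrite mulrA.
by rewrite cost_scale ?mulr_ge0 ?(ltW r0)// powRM ?(ltW r0)// mulrA.
Qed.

End pair_of_pieces.

(* The infimum [m] of the costs satisfies [m <= (1 - 2 / N) m + c / N] with [c]
   close to [m], where [N] is the number of pieces; the cover with cost [c] is
   fixed before [N], which depends on it through [eps]. *)
Lemma hausdorff_measure_overlap s (rho M : R) A : 0 < s -> 0 < rho < 1 ->
  A `<=` [set x | `|x| <= M] ->
  (forall eps : R, 0 < eps -> exists (I : finType) (t : I -> R) (i j : I) (r : R),
    [/\ 0 < r <= rho, #|I|%:R * r `^ s = 1,
        A `<=` \bigcup_k [set t k + r * x | x in A],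
        i != j & `|t i - t j| <= eps * r]) ->
  hausdorff_measure s A = 0%E.
Proof.
move=> s0 /andP[rho0 rho1] AM H; apply: hausdorff_measure_eq0 => // e c e0 c0.
pose S := [set cost s L | L in covers e A].
have S0 : has_inf S.
  split; last by exists 0 => _ [L _ <-]; exact: cost_ge0.
  by have [L LA] := covers_exists e0 AM; exists (cost s L); exists L.
pose m := inf S.
have Sm L : covers e A L -> m <= cost s L.
  by move=> LA; apply: ge_inf => //; [exact: S0.2|exists L].
have mS (d : R) : 0 < d -> exists2 L, covers e A L & cost s L < m + d.
  by move=> d0; have [_ [L LA <-]] := inf_adherent d0 S0; exists L.
have [m0|m0] := leP m 0.
  by have [L LA Lc] := mS _ c0; exists L => //; lra.
exfalso.
(* Budget: the shared copy costs less than [4 / 3 * 9 / 8 = 3 / 2] times [m], and the others at most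
   [(N - 2) m + m / 2 - m / N], together less than [N m]. *)
have [L1 L1A L1m] : exists2 L, covers e A L & cost s L < m + m / 8.
  by apply: mS; lra.
have L10 : all (fun J : R * R => 0 < J.2) L1.
  by apply: sub_all L1A.1 => J /andP[].
pose b : R := (4 / 3) `^ s^-1.
have b1 : 0 < b - 1.
  have : 1 `^ s^-1 < (4 / 3 : R) `^ s^-1.
    by apply: gt0_ltr_powR; rewrite ?invr_gt0 ?nnegrE//; lra.
  by rewrite powR1 -/b subr_gt0.
have bs : b `^ s = 4 / 3 by rewrite /b -powRrM mulVf ?gt_eqF// powRr1//; lra.
have [eps1 eps10 L1eps] := min_length b1 L10.
(* The first term keeps the lengthening within the factor [b], the second keeps the scaled intervals
   no longer than [e]. *)
pose eps : R := Num.min eps1 ((1 - rho) * e).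
have eps0 : 0 < eps by rewrite lt_min eps10 mulr_gt0//; lra.
have [I [t [i [j [r [/andP[r0 rrho] Ir At ij tij]]]]]] := H eps eps0.
have N2 : (2 <= #|I|)%N by have := max_card (pred2 i j); rewrite card2 ij.
have N0 : (0 : R) < #|I|%:R by rewrite ltr0n; exact: ltnW.
have [L2 L2A L2m] : exists2 L, covers e A L & cost s L < m + m / (2 * #|I|%:R).
  by apply: mS; rewrite divr_gt0// mulr_gt0.
have L20 : all (fun J : R * R => 0 < J.2) L2.
  by apply: sub_all L2A.1 => J /andP[].
have r1 : r <= 1 by lra.
have L1e : all (fun J : R * R => r * (J.2 + eps) <= e) L1.
  apply: sub_all L1A.1 => J /andP[J0 Je].
  have h : eps <= (1 - rho) * e by rewrite ge_min lexx orbT.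
  rewrite (@le_trans _ _ (rho * (J.2 + eps)))// ?ler_pM2r ?addr_gt0//.
  have : rho * J.2 <= rho * e by rewrite ler_pM2l.
  have : rho * eps <= eps by rewrite ler_piMl ?ltW.
  lra.
have L1b : all (fun J : R * R => J.2 + eps <= b * J.2) L1.
  apply: sub_all L1eps => J; have : eps <= eps1 by rewrite ge_min lexx.
  lra.
have b0 : 0 <= b by lra.
have := le_trans (Sm _ (covers_refine r0 r1 eps0 At tij L1e L1A L2A))
  (cost_refine t s0 r0 eps0 ij b0 L10 L20 L1b).
rewrite bs -(ler_pM2l N0) mulrA Ir mul1r.
set N : R := #|I|%:R in N0 L2m *.
have N2' : 2 <= N by rewrite ler_nat.
have : (N - 2) * cost s L2 <= (N - 2) * (m + m / (2 * N)).
  by rewrite ler_wpM2l ?subr_ge0 ?(ltW L2m).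
have -> : (N - 2) * (m + m / (2 * N)) = (N - 2) * m + m / 2 - m / N.
  by field; lra.
have : 0 < m / N by rewrite divr_gt0.
lra.
Qed.

End interval_covers.

(** * Pieces of the projections *)

Section projected_corner.
Variable R : realType.
Implicit Types (d theta : R) (a : nat -> bool) (p : bool * bool).

Definition digit_series d a : R := limn [series (a n)%:R * d ^+ n]_n.

Lemma cvg_digit_series d a : 0 < d < 1 -> cvgn [series (a n)%:R * d ^+ n]_n.
Proof.
move=> /andP[d0 d1]; apply: (@series_le_cvg _ _ (geometric 1 d)) => [n|n|n|].
- by rewrite mulr_ge0// exprn_ge0// ltW.
- by rewrite /= mul1r exprn_ge0// ltW.
- by rewrite /= mul1r ler_piMl ?exprn_ge0 ?(ltW d0)//; case: (a n).
- by apply: is_cvg_geometric_series; rewrite gtr0_norm.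
Qed.

Lemma digit_seriesS d a : 0 < d < 1 ->
  digit_series d a = (a 0%N)%:R + d * digit_series d (a \o S).
Proof.
move=> d01; have cS := @cvg_digit_series d (a \o S) d01.
apply: cvg_lim => //; rewrite -cvg_shiftS /=.
rewrite (_ : (fun n => _) = (fun n => (a 0%N)%:R + d * [series ((a \o S) n)%:R * d ^+ n]_n n)).
  by apply: cvgD; [exact: cvg_cst|apply: cvgZr].
apply/funext => n; rewrite /series/= big_nat_recl// expr0 mulr1 mulr_sumr.
by congr (_ + _); apply: eq_bigr => i _; rewrite exprS mulrCA.
Qed.

Lemma digit_series_split d a n : 0 < d < 1 ->
  digit_series d a =
  \sum_(i < n) (a i)%:R * d ^+ i + d ^+ n * digit_series d (fun i => a (n + i)%N).
Proof.
move=> d01; elim: n => [|n IH]; first by rewrite big_ord0 add0r expr0 mul1r.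
rewrite IH big_ord_recr/= digit_seriesS//= addn0 exprSr.
rewrite (_ : (fun i => a (n.+1 + i)%N) = (fun i => a (n + i)%N) \o S); first ring.
by apply/funext => i /=; rewrite addSnnS.
Qed.

Lemma digit_series_bounds d a : 0 < d < 1 ->
  0 <= (1 - d) * digit_series d a <= 1.
Proof.
move=> /[dup] d01 /andP[d0 d1].
have cS := @cvg_digit_series d a d01.
apply/andP; split.
  rewrite mulr_ge0 ?subr_ge0 ?(ltW d1)//; apply: limr_ge => //.
  by near=> n; apply: sumr_ge0 => i _; rewrite mulr_ge0// exprn_ge0// ltW.
rewrite mulrC -ler_pdivlMr ?subr_gt0//; apply: limr_le => //; near=> n.
apply: le_trans (@geometric_le_lim R n 1 d _ d0 _) => //; last by rewrite gtr0_norm.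
apply: ler_sum => i _; rewrite /= mul1r ler_piMl ?exprn_ge0 ?(ltW d0)//.
by case: (a i).
Unshelve. all: by end_near.
Qed.

Definition digit_proj theta p : R := p.1%:R * cos theta + p.2%:R * sin theta.

Lemma proj_corner_bounded d theta : 0 < d < 1 ->
  proj_dir theta @` four_corner d `<=` [set x | `|x| <= 2].
Proof.
move=> d01 _ [[x y] [/= [a _ <-] [b _ <-]] <-] /=.
have /andP[a0 a1] := @digit_series_bounds d a d01.
have /andP[b0 b1] := @digit_series_bounds d b d01.
rewrite /proj_dir/= (le_trans (ler_normD _ _))// !normrM.
rewrite [leRHS](_ : 2 = 1 * 1 + 1 * 1); last by ring.
have c1 : `|cos theta| <= 1 by rewrite ler_norml cos_geN1 cos_le1.
have s1 : `|sin theta| <= 1 by rewrite ler_norml sin_geN1 sin_le1.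
rewrite -!normrM; apply: lerD; rewrite normrM ler_pM//.
  by rewrite ger0_norm.
by rewrite ger0_norm.
Qed.

Lemma proj_corner_pieces d theta n : 0 < d < 1 ->
  proj_dir theta @` four_corner d `<=` \bigcup_(w : {ffun 'I_n -> bool * bool})
   [set (1 - d) * (\sum_(i < n) digit_proj theta (w i) * d ^+ i) + d ^+ n * x | x in
   proj_dir theta @` four_corner d].
Proof.
move=> d01 _ [[x y] [/= [a _ <-] [b _ <-]] <-] /=.
exists [ffun i : 'I_n => (a i, b i)] => //=.
exists (proj_dir theta ((1 - d) * digit_series d (fun i => a (n + i)%N),
                        (1 - d) * digit_series d (fun i => b (n + i)%N))).
  eexists; last by reflexivity.
  split => /=; first by exists (fun i => a (n + i)%N).
  by exists (fun i => b (n + i)%N).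
under eq_bigr do rewrite ffunE /digit_proj/= mulrDl mulrAC [_ * sin _ * _]mulrAC.
rewrite big_split/= -!mulr_suml /proj_dir/=.
rewrite -!/(digit_series d _) (@digit_series_split d a n d01) (@digit_series_split d b n d01).
ring.
Qed.

Lemma powR_corner_dim d : 0 < d < 1 -> d `^ four_corner_dim d = 4^-1.
Proof.
move=> /andP[d0 d1].
have ld : ln d != 0 by rewrite lt_eqF// ln_lt0// d0.
rewrite /powR gt_eqF// /four_corner_dim div1r lnV ?posrE// invrN mulrN mulNr divfK//.
by rewrite expRN lnK ?posrE.
Qed.

Lemma corner_dim_gt0 d : 0 < d < 1 -> 0 < four_corner_dim d.
Proof.
move=> /andP[d0 d1]; rewrite /four_corner_dim div1r lnV ?posrE//.
by rewrite divr_gt0 ?ln_gt0 ?ltr1n// oppr_gt0 ln_lt0// d0.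
Qed.

Lemma hausdorff_proj_corner_eq0 d theta : 0 < d < 1 ->
  (forall eps : R, 0 < eps -> exists n (u w : {ffun 'I_n -> bool * bool}), u != w /\
    `|\sum_(i < n) (digit_proj theta (u i) - digit_proj theta (w i)) * d ^+ i|
      <= eps * d ^+ n) ->
  hausdorff_measure (four_corner_dim d) (proj_dir theta @` four_corner d) = 0%E.
Proof.
move=> /[dup] d01 /andP[d0 d1] H.
apply: (hausdorff_measure_overlap (corner_dim_gt0 d01) d01 (proj_corner_bounded d01)).
move=> eps /H[n [u [w [uw uweps]]]].
exists {ffun 'I_n -> bool * bool}, (fun w : {ffun 'I_n -> bool * bool} =>
  (1 - d) * \sum_(i < n) digit_proj theta (w i) * d ^+ i).
exists u, w, (d ^+ n); split => //.
(* Distinct words have positive length, hence [d ^+ n <= d]. *)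
- case: n u w uw {uweps} => [u w /eqP[]|n u w _]; first by apply/ffunP => -[].
  by rewrite exprn_gt0//= exprS ler_piMr ?(ltW d0)// exprn_ile1// ltW.
- rewrite card_ffun card_prod card_bool card_ord natrX -(powR_mulrn n (ltW d0)).
  by rewrite powRAC powR_corner_dim// powR_mulrn// -exprMn divff ?expr1n// pnatr_eq0.
- exact: proj_corner_pieces.
rewrite -mulrBr -sumrB; under eq_bigr do rewrite -mulrBl.
rewrite normrM; apply: le_trans uweps; rewrite ler_piMl// ger0_norm ?subr_ge0 ?ltW//.
by rewrite gtrBl.
Qed.

End projected_corner.

(** * Porous sets are null *)

Section porous_sets.
Variable R : realType.
Implicit Types (B : set R) (x y r : R).
Local Notation mu := (@lebesgue_measure R).

Lemma measurable_ball x r : measurable (ball x r).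
Proof. by rewrite ball_itv; exact: measurable_itv. Qed.

Lemma lebesgue_measure_porous_le B x y r (kappa : R) : measurable B ->
  0 < kappa -> 0 < r -> ball y (kappa * r) `<=` ball x r ->
  B `&` ball y (kappa * r) `<=` set0 ->
  (mu (B `&` ball x r) * (mu (ball x r))^-1 <= (1 - kappa)%:E)%E.
Proof.
move=> mB k0 r0 yx By.
have kr0 : 0 < kappa * r by rewrite mulr_gt0.
have mE : mu (ball x r `\` ball y (kappa * r)) = (r *+ 2 - (kappa * r) *+ 2)%:E.
  transitivity (mu (ball x r) - mu (ball y (kappa * r)))%E.
    rewrite -[in RHS](setIidr yx); apply: measureD; [exact: measurable_ball..|].
    by rewrite [ltLHS](lebesgue_measure_ball _ (ltW r0)) ltry.
  by rewrite !lebesgue_measure_ball// ltW.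
rewrite lebesgue_measure_ball ?(ltW r0)// inver gt_eqF ?mulrn_wgt0//=.
rewrite lee_pdivrMr ?mulrn_wgt0// -EFinM.
rewrite (_ : _ * _ = r *+ 2 - (kappa * r) *+ 2); last first.
  by rewrite -[r *+ 2]mulr_natl -[(_ * r) *+ 2]mulr_natl; ring.
rewrite -mE; apply: le_measure; rewrite ?inE.
- by apply: measurableI => //; exact: measurable_ball.
- by apply: measurableD; exact: measurable_ball.
move=> z [Bz xz]; split => // yz; exact: (By z).
Qed.

(** The missing balls keep the relative measure of [B] around [x] at most [1 - kappa] along radii
    tending to [0], so no point of [B] is a density point. *)
Lemma negligible_porous B : measurable B ->
  (forall x, B x -> exists2 kappa : R, 0 < kappa &
    forall e : R, 0 < e -> exists r y, [/\ 0 < r < e,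
      ball y (kappa * r) `<=` ball x r & B `&` ball y (kappa * r) `<=` set0]) ->
  mu.-negligible B.
Proof.
move=> mB H; apply: negligibleS (lebesgue_density mB) => x Bx /= cvg1.
have [kappa k0 Hk] := H _ Bx.
move: cvg1; rewrite indicE mem_set//= => cvg1.
have h : nbhs (1%:E : \bar R) [set z | ((1 - kappa)%:E < z)%E].
  by apply: open_ereal_gt'; rewrite lte_fin ltrBlDr ltrDl.
have [e /= e0 He] := cvg1 _ h.
have [r [y [/andP[r0 re] yx By]]] := Hk e e0.
have := He r; rewrite /= sub0r normrN gtr0_norm// => /(_ re r0).
by rewrite ltNge (lebesgue_measure_porous_le mB k0 r0 yx By).
Qed.

End porous_sets.

(** * Zeros of sinusoids *)

Section trigonometry.
Variable R : realType.
Implicit Types (x y k : R).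

Lemma lipschitz_ge0 (f df : R -> R) x :
  (forall x, is_derive x 1 f (df x)) -> (forall x, `|df x| <= 1) -> f 0 = 0 ->
  0 <= x -> `|f x| <= x.
Proof.
move=> fdf df1 f0 x0.
have [z _] : exists2 c, c \in `[0, x]%R & f x - f 0 = df c * (x - 0).
  apply: MVT_segment => //; apply: derivable_within_continuous => z _.
  exact: ex_derive.
rewrite f0 !subr0 => ->.
by rewrite normrM (ger0_norm x0) ler_piMl.
Qed.

Lemma norm_sin_le x : `|sin x| <= `|x|.
Proof.
have h y : 0 <= y -> `|sin y| <= y.
  apply: (lipschitz_ge0 (df := cos)); last by rewrite sin0.
  by move=> z; rewrite ler_norml cos_geN1 cos_le1.
have [x0|x0] := leP 0 x; first by rewrite (ger0_norm x0) h.
by rewrite -[leRHS]normrN -[leLHS]normrN -sinN [leRHS]gtr0_norm ?h ?oppr_gt0 ?oppr_ge0 ?(ltW x0).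
Qed.

Lemma norm_atan_le x : `|atan x| <= `|x|.
Proof.
have h y : 0 <= y -> `|atan y| <= y.
  apply: (lipschitz_ge0 (df := fun x => (1 + x ^+ 2)^-1)); last by rewrite atan0.
  move=> z; have z1 : 1 <= 1 + z ^+ 2 by rewrite lerDl sqr_ge0.
  by rewrite ger0_norm ?invr_ge0 ?(le_trans ler01)// invf_le1// (lt_le_trans ltr01).
have [x0|x0] := leP 0 x; first by rewrite (ger0_norm x0) h.
by rewrite -[leRHS]normrN -[leLHS]normrN -atanN [leRHS]gtr0_norm ?h ?oppr_gt0 ?oppr_ge0 ?(ltW x0).
Qed.

(* A zero of [X cos + Y sin] near [x] is [x - atan (g / q)], where [g] and [q]
   are the value and the derivative at [x]. *)
Lemma trig_zero_near (X Y : R) x (eta : R) :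
  1 / 2 <= X ^+ 2 + Y ^+ 2 -> X ^+ 2 + Y ^+ 2 <= 4 -> eta <= 1 / 2 ->
  `|X * cos x + Y * sin x| <= eta ->
  exists2 y, `|y - x| <= 2 * eta &
    forall z, `|X * cos z + Y * sin z| <= 2 * `|z - y|.
Proof.
move=> lo hi eta1 geta.
set g := X * cos x + Y * sin x in geta *.
pose q := Y * cos x - X * sin x.
have cs := cos2Dsin2 x.
(* Value and derivative cannot both be small, so [|g| <= 1 / 2] forces [|q| >= 1 / 2]. *)
have gq : g ^+ 2 + q ^+ 2 = X ^+ 2 + Y ^+ 2.
  rewrite -[RHS]mulr1 -cs /g /q; ring.
have g2 : g ^+ 2 <= 1 / 4.
  by rewrite -real_normK ?num_real//; have := normr_ge0 g; nra.
have q2 : (1 / 2) ^+ 2 <= `|q| ^+ 2 by rewrite real_normK ?num_real//; lra.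
have q1 : 1 / 2 <= `|q|.
  by move: q2; rewrite ler_pXn2r// ?nnegrE//; lra.
have q0 : q != 0 by rewrite -normr_gt0; lra.
pose h := atan (- (g / q)).
have hle : `|h| <= 2 * eta.
  rewrite (le_trans (norm_atan_le _))// normrN normrM normfV ler_pdivrMr ?normr_gt0//.
  have := normr_ge0 g; nra.
have sh : sin h = - (g / q) * cos h.
  have ch : cos h != 0.
    by rewrite cos_atan invr_neq0// gt_eqF// sqrtr_gt0 ltr_pwDl// sqr_ge0.
  have : tan h = - (g / q) by exact: atanK.
  by rewrite /tan => <-; rewrite divfK.
pose y := x + h.
have gy : X * cos y + Y * sin y = 0.
  rewrite /y cosD sinD.
  rewrite (_ : _ + _ = g * cos h + q * sin h); last by rewrite /g /q; ring.
  by rewrite sh; field.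
exists y; first by rewrite /y addrC addKr.
(* Around its zero [y] the sinusoid is [q' * sin (z - y)], with amplitude at most [2]. *)
move=> z; pose q' := Y * cos y - X * sin y.
have [k ->] : exists k, z = y + k by exists (z - y); rewrite addrC subrK.
rewrite (_ : y + k - y = k); last ring.
rewrite cosD sinD.
rewrite [X in `|X| <= _](_ : _ = (X * cos y + Y * sin y) * cos k + q' * sin k).
  rewrite gy mul0r add0r normrM ler_pM// ?norm_sin_le//.
  have cs' := cos2Dsin2 y.
  have : (X * cos y + Y * sin y) ^+ 2 + q' ^+ 2 = X ^+ 2 + Y ^+ 2.
    by rewrite -[RHS]mulr1 -cs' /q'; ring.
  rewrite gy expr0n/= add0r => q'E.
  have : `|q'| ^+ 2 <= 2 ^+ 2 by rewrite real_normK ?num_real//; lra.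
  by rewrite ler_pXn2r// ?nnegrE.
by rewrite /q'; ring.
Qed.

End trigonometry.

(** * Almost every overlap direction *)

Section overlaps_ae.
Variable R : realType.
Implicit Types (d theta : R) (u w : nat -> bool * bool).
Local Notation mu := (@lebesgue_measure R).

Lemma exprn_small d (e : R) : 0 < d < 1 -> 0 < e -> exists k, d ^+ k <= e.
Proof.
move=> /andP[d0 d1] e0.
have /cvgr0_norm_le/(_ e e0)[k _ h] : d ^+ n @[n --> \oo] --> 0.
  by apply: cvg_expr; rewrite gtr0_norm.
by exists k; have := h k (leqnn k); rewrite ger0_norm// exprn_ge0// ltW.
Qed.

Lemma digit_sum_le d (c : nat -> R) n : 0 < d -> d <= 1 / 6 ->
  (forall i, `|c i| <= 1) -> `|\sum_(i < n) c i * d ^+ i| <= 6 / 5.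
Proof.
move=> d0 d6; elim: n c => [|n IH] c c1; first by rewrite big_ord0 normr0; lra.
rewrite big_ord_recl expr0 mulr1.
under eq_bigr do rewrite lift0 exprS mulrCA.
rewrite -mulr_sumr (le_trans (ler_normD _ _))// normrM (gtr0_norm d0).
have := IH (fun i => c i.+1) (fun i => c1 i.+1).
set S := `|_|; have S0 : 0 <= S by exact: normr_ge0.
by have /= := c1 0%N; nra.
Qed.

Lemma digit_sum_ge d (c : nat -> R) n : 0 < d -> d <= 1 / 6 ->
  (forall i, `|c i| <= 1) -> `|c 0%N| = 1 ->
  4 / 5 <= `|\sum_(i < n.+1) c i * d ^+ i|.
Proof.
move=> d0 d6 c1 c01; rewrite big_ord_recl expr0 mulr1.
under eq_bigr do rewrite lift0 exprS mulrCA.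
rewrite -mulr_sumr; have := @digit_sum_le d (fun i => c i.+1) n d0 d6 (fun i => c1 i.+1).
set S := \sum_(i < n) _ => S1.
have : `|d * S| <= 1 / 5 by rewrite normrM (gtr0_norm d0); have := normr_ge0 S; nra.
have := ler_normB (c 0%N + d * S) (d * S).
rewrite addrK; change (c ord0) with (c 0%N); rewrite c01; lra.
Qed.

Definition diff1 u w i : R := (u i).1%:R - (w i).1%:R.
Definition diff2 u w i : R := (u i).2%:R - (w i).2%:R.

Lemma digit_proj_diff d theta u w n :
  \sum_(i < n) (digit_proj theta (u i) - digit_proj theta (w i)) * d ^+ i =
  (\sum_(i < n) diff1 u w i * d ^+ i) * cos theta +
  (\sum_(i < n) diff2 u w i * d ^+ i) * sin theta.
Proof.
rewrite !mulr_suml -big_split; apply: eq_bigr => i _ /=.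
by rewrite /digit_proj /diff1 /diff2; ring.
Qed.

(** These are the amplitude bounds for [trig_zero_near]: the first digits differ in some coordinate,
    whose sum is then at least [1 - 1 / 5] in absolute value. *)
Lemma diff_square_bounds d u w n : 0 < d -> d <= 1 / 6 -> u 0%N != w 0%N ->
  1 / 2 <= (\sum_(i < n.+1) diff1 u w i * d ^+ i) ^+ 2 +
           (\sum_(i < n.+1) diff2 u w i * d ^+ i) ^+ 2 <= 4.
Proof.
move=> d0 d6 uw.
have b (x y : bool) : `|x%:R - y%:R : R| <= 1.
  by case: x; case: y; rewrite ?subrr ?subr0 ?sub0r ?normrN ?normr0 ?normr1.
have b1 (x y : bool) : x != y -> `|x%:R - y%:R : R| = 1.
  by case: x; case: y => // _; rewrite ?subr0 ?sub0r ?normrN ?normr1.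
have h1 := @digit_sum_le d (diff1 u w) n.+1 d0 d6 (fun i => b _ _).
have h2 := @digit_sum_le d (diff2 u w) n.+1 d0 d6 (fun i => b _ _).
have sq1 (x : R) : 4 / 5 <= `|x| -> 1 / 2 <= x ^+ 2.
  by rewrite -(real_normK (num_real x)); nra.
have sq2 (x : R) : `|x| <= 6 / 5 -> x ^+ 2 <= 2.
  by rewrite -(real_normK (num_real x)); have := normr_ge0 x; nra.
have [g1|g2] : 4 / 5 <= `|\sum_(i < n.+1) diff1 u w i * d ^+ i| \/
               4 / 5 <= `|\sum_(i < n.+1) diff2 u w i * d ^+ i|.
  have : ((u 0%N).1 != (w 0%N).1) || ((u 0%N).2 != (w 0%N).2).
    by move: uw; rewrite -negb_and; case: (u 0%N) (w 0%N) => ? ? [? ?].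
  move=> /orP[/b1 e|/b1 e]; [left|right].
    exact: digit_sum_ge (fun i => b _ _) e.
  exact: digit_sum_ge (fun i => b _ _) e.
- apply/andP; split; first by rewrite (le_trans (sq1 _ g1))// lerDl sqr_ge0.
  by have := sq2 _ h1; have := sq2 _ h2; lra.
- apply/andP; split; first by rewrite (le_trans (sq1 _ g2))// lerDr sqr_ge0.
  by have := sq2 _ h1; have := sq2 _ h2; lra.
Qed.

(** The inequality is strict to make the set open, hence measurable. *)
Definition overlap d (eps : R) : set R :=
  \bigcup_n \bigcup_(p in [set p : {ffun 'I_n -> bool * bool} * {ffun 'I_n -> bool * bool} |
      p.1 != p.2])
    [set theta | `|\sum_(i < n) (digit_proj theta (p.1 i) - digit_proj theta (p.2 i)) * d ^+ i|
       < eps * d ^+ n].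

Lemma continuous_digit_proj (p : bool * bool) : continuous (fun theta : R => digit_proj theta p).
Proof.
move=> x; apply: cvgD; apply: cvgMr.
  exact: continuous_cos.
exact: continuous_sin.
Qed.

Lemma open_overlap d eps : open (overlap d eps).
Proof.
apply: bigcup_open => n _; apply: bigcup_open => p _.
pose f theta : R := \sum_(i < n) (digit_proj theta (p.1 i) - digit_proj theta (p.2 i)) * d ^+ i.
have cf : continuous f.
  apply: (continuous_big (op := +%R)) => [|i _ x]; first exact: add_continuous.
  by apply: cvgMl; apply: cvgB; exact: continuous_digit_proj.
rewrite (_ : [set _ | _] = (fun x => `|f x|) @^-1` [set y | y < eps * d ^+ n])//.
by apply: open_comp => [x _|]; [apply: cvg_norm; exact: cf|exact: open_lt].
Qed.

Lemma negligible_no_overlap d (C eps : R) (IP : set R) : 0 < d -> d <= 1 / 6 ->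
  0 < C -> 0 < eps -> measurable IP ->
  (forall theta, IP theta -> forall n, exists u w, u 0%N != w 0%N /\
    `|\sum_(i < n.+1) (digit_proj theta (u i) - digit_proj theta (w i)) * d ^+ i|
       <= C * d ^+ n.+1) ->
  mu.-negligible (IP `\` overlap d eps).
Proof.
move=> d0 d6 C0 eps0 mIP H; apply: negligible_porous.
  by apply: measurableD => //; apply: measurable_realfun.open_measurable; exact: open_overlap.
move=> x [IPx nox].
have D0 : 0 < 2 * C + eps by lra.
(* With [D = d ^+ k.+1], a zero [y] lies within [2 C D] of [x], and the ball of radius [eps D / 2]
   about [y] consists of overlaps; it fits into the ball of radius [(2 C + eps) D] about [x]. *)
exists (eps / (2 * (2 * C + eps))); first by rewrite divr_gt0// mulr_gt0.
move=> e e0.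
(* The first term gives [C D <= 1 / 2], as [trig_zero_near] requires; the second makes the radius
   less than [e]. *)
pose e1 : R := Num.min (1 / (2 * C)) (e / (2 * (2 * C + eps))).
have e10 : 0 < e1 by rewrite lt_min !divr_gt0// mulr_gt0.
have [|k dk] := @exprn_small d e1 _ e10; first by apply/andP; split; lra.
have dk1 : d ^+ k.+1 <= e1.
  by apply: le_trans dk; rewrite exprS ler_piMl ?exprn_ge0 ?(ltW d0)//; lra.
have dk0 : 0 < d ^+ k.+1 by rewrite exprn_gt0.
have [u [w [uw Cuw]]] := H x IPx k.
have Cd : C * d ^+ k.+1 <= 1 / 2.
  have : d ^+ k.+1 <= 1 / (2 * C) by rewrite (le_trans dk1)// ge_min lexx.
  by rewrite ler_pdivlMr ?mulr_gt0//; lra.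
have re : (2 * C + eps) * d ^+ k.+1 < e.
  have : d ^+ k.+1 <= e / (2 * (2 * C + eps)) by rewrite (le_trans dk1)// ge_min lexx orbT.
  by rewrite ler_pdivlMr ?mulr_gt0//; lra.
have /andP[lo hi] := diff_square_bounds k d0 d6 uw.
move: Cuw; rewrite digit_proj_diff => /(trig_zero_near lo hi Cd)[y yx yz].
exists ((2 * C + eps) * d ^+ k.+1), y.
have -> : eps / (2 * (2 * C + eps)) * ((2 * C + eps) * d ^+ k.+1) = eps / 2 * d ^+ k.+1.
  by field; lra.
split.
- by rewrite re mulr_gt0.
- move=> z; rewrite /ball/= => zy.
  rewrite (_ : x - z = (y - z) - (y - x)); last ring.
  rewrite (le_lt_trans (ler_normB _ _))//.
  have : 0 < eps * d ^+ k.+1 by rewrite mulr_gt0.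
  lra.
move=> z [[_ noz]]; rewrite /ball/= distrC => zy; apply: noz.
exists k.+1 => //; exists ([ffun i : 'I_k.+1 => u i], [ffun i : 'I_k.+1 => w i]) => /=.
  by apply/eqP => /ffunP/(_ ord0); rewrite !ffunE => /eqP; exact/negP.
under eq_bigr do rewrite !ffunE.
rewrite digit_proj_diff (le_lt_trans (yz z))//; lra.
Qed.

(** The exceptional directions lie in the countable union of the null sets for
    [eps = 1 / (k + 1)]. *)
Lemma hausdorff_proj_corner_ae d (C : R) (IP : set R) : 0 < d -> d <= 1 / 6 ->
  0 < C -> measurable IP ->
  (forall theta, IP theta -> forall n, exists u w, u 0%N != w 0%N /\
    `|\sum_(i < n.+1) (digit_proj theta (u i) - digit_proj theta (w i)) * d ^+ i|
       <= C * d ^+ n.+1) ->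
  {ae mu, forall theta, IP theta ->
    hausdorff_measure (four_corner_dim d) (proj_dir theta @` four_corner d) = 0%E}.
Proof.
move=> d0 d6 C0 mIP H.
have h k : mu.-negligible (IP `\` overlap d k.+1%:R^-1).
  by apply: negligible_no_overlap H.
apply: negligibleS (negligible_bigcup h) => theta /=.
move=> /not_implyP[IPt nH].
have [k nok] : exists k, ~ overlap d k.+1%:R^-1 theta.
  apply/existsNP => ov; apply: nH; apply: hausdorff_proj_corner_eq0.
    by apply/andP; split; lra.
  move=> eps eps0.
  have [n _ [[u w] /= uw ouw]] := ov (Num.truncn eps^-1).
  exists n, u, w; split => //; rewrite (le_trans (ltW ouw))// ler_pM2r ?exprn_gt0//.
  by rewrite invf_ple ?posrE ?ltr0n// ltW// truncnS_gt.
by exists k.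
Qed.

End overlaps_ae.

(** * The interval of directions *)

Section roots.
Variable R : realType.
Implicit Types x y : R.

Lemma P_deltaE x :
  P_delta.[x] = 1 - 7 * x + 3 * x ^+ 2 + 4 * x ^+ 3 - 2 * x ^+ 4 - x ^+ 5.
Proof. by rewrite /P_delta !hornerE. Qed.

Lemma P_delta_decr x y : 0 <= x -> x < y -> y <= 1 / 6 ->
  P_delta.[y] < P_delta.[x].
Proof.
move=> x0 xy y6; rewrite !P_deltaE -subr_gt0.
(* The divided difference of [- P_delta]; on [[0, 1 / 6]] its negative terms amount to at most
   [3]. *)
set q : R := 7 - 3 * (x + y) - 4 * (x ^+ 2 + x * y + y ^+ 2)
   + 2 * (x ^+ 3 + x ^+ 2 * y + x * y ^+ 2 + y ^+ 3)
   + (x ^+ 4 + x ^+ 3 * y + x ^+ 2 * y ^+ 2 + x * y ^+ 3 + y ^+ 4).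
rewrite (_ : _ - _ = (y - x) * q); last by rewrite /q; ring.
rewrite mulr_gt0 ?subr_gt0//.
have y0 : 0 <= y by lra.
have n2 : 0 <= x ^+ 3 + x ^+ 2 * y + x * y ^+ 2 + y ^+ 3.
  by rewrite !addr_ge0 ?mulr_ge0 ?exprn_ge0.
have n4 : 0 <= x ^+ 4 + x ^+ 3 * y + x ^+ 2 * y ^+ 2 + x * y ^+ 3 + y ^+ 4.
  by rewrite !addr_ge0 ?mulr_ge0 ?exprn_ge0.
have : x ^+ 2 + x * y + y ^+ 2 <= 1 / 2 by nra.
rewrite /q; lra.
Qed.

Lemma P_delta_unique_root :
  exists! delta : R, 1 / 9 < delta < 1 / 6 /\ root P_delta delta.
Proof.
have a0 : 0 < P_delta.[1 / 9 : R] by rewrite P_deltaE; lra.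
have b0 : P_delta.[1 / 6 : R] < 0 by rewrite P_deltaE; lra.
have [||x /andP[x1 x2] rx] := @poly_ivt R (- P_delta) (1 / 9) (1 / 6); first lra.
  by rewrite !hornerN oppr_le0 oppr_ge0 !ltW.
rewrite rootN in rx; have /rootP x0 := rx.
exists x; split.
  split => //; rewrite !lt_neqAle x1 x2 !andbT.
  apply/andP; split; apply/eqP => xE; first by move: a0; rewrite xE x0 ltxx.
  by move: b0; rewrite -xE x0 ltxx.
move=> y [/andP[y1 y2] /rootP y0].
have [xy|xy|//] := ltgtP x y.
  have : P_delta.[y] < P_delta.[x] by apply: P_delta_decr => //; lra.
  by rewrite x0 y0 ltxx.
have : P_delta.[x] < P_delta.[y] by apply: P_delta_decr => //; lra.
by rewrite x0 y0 ltxx.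
Qed.

(** [11 / 71] is the left end of the range on which the polynomial inequalities were checked;
    [P_delta] is still positive there. *)
Lemma root_P_delta_gt x : 1 / 9 < x < 1 / 6 -> root P_delta x -> 11 / 71 < x.
Proof.
move=> /andP[x1 x2] /rootP x0; rewrite ltNge; apply/negP => x3.
have p0 : 0 < P_delta.[11 / 71 : R] by rewrite P_deltaE; lra.
move: x3; rewrite le_eqVlt => /predU1P[x3|x3]; first by rewrite x3 in x0; lra.
have : P_delta.[11 / 71] < P_delta.[x] by apply: P_delta_decr => //; lra.
by rewrite x0; lra.
Qed.

Lemma digit_proj_slice (theta : R) p : cos (theta - pi / 2) != 0 ->
  digit_proj theta p = cos (theta - pi / 2) * slice (tan (theta - pi / 2)) p.
Proof.
move=> c0; rewrite /digit_proj /slice /tan mulrBr mulrA [cos _ * (_ / _)]mulrC divfK//.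
rewrite -[in cos theta](subrK (pi / 2) theta) -[in sin theta](subrK (pi / 2) theta).
by rewrite cosDpihalf sinDpihalf; ring.
Qed.

(** The corners [(0, 0)] and [(1, 1)] are put in front as the digit [-(1 - l)]. Dividing by
    [1 - d >= 5 / 6] turns the bound [2] into at most [3]. *)
Lemma expandable_overlaps (d l : R) (n : nat) : 0 < d -> d <= 1 / 6 -> window l d ->
  expandable l d ((1 - l) * (1 - d) / d) ->
  exists u w : nat -> bool * bool, u 0%N != w 0%N /\
    `|\sum_(i < n.+1) (slice l (u i) - slice l (w i)) * d ^+ i| <= 3 * d ^+ n.+1.
Proof.
move=> d0 d6 win /(expandable_words n d0 d6 win)[u [w uw]].
exists (fun i => if i is j.+1 then u j else (false, false)),
       (fun i => if i is j.+1 then w j else (true, true)); split => //.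
rewrite big_ord_recl/= expr0 mulr1.
under eq_bigr => i _ do rewrite /= exprS mulrCA.
rewrite -mulr_sumr.
set S := \sum_(i < n) _ in uw *.
have d1 : 0 < 1 - d by lra.
rewrite -(ler_pM2l d1) -[X in X * `| _ |](gtr0_norm d1) -normrM.
rewrite (_ : _ * _ = - (d * ((1 - l) * (1 - d) / d - (1 - d) * S))); last first.
  by rewrite /slice/=; field; lra.
rewrite normrN normrM (gtr0_norm d0) (le_trans (ler_wpM2l (ltW d0) uw))//.
rewrite exprS.
have : 0 < d * d ^+ n by rewrite mulr_gt0// exprn_gt0.
nra.
Qed.

End roots.

Theorem corollary1p2 (R : realType) :
  (exists! delta : R, 1 / 9 < delta < 1 / 6 /\ root P_delta delta) /\
  (forall delta : R, 1 / 9 < delta < 1 / 6 -> root P_delta delta ->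
   forall d : R, delta < d -> d <= 1 / 6 ->
   exists IP : set R,
     [/\ IP `<=` `[0, pi[,
         measurable IP,
         (0 < lebesgue_measure IP)%E &
         {ae lebesgue_measure, forall theta, IP theta ->
            hausdorff_measure (four_corner_dim d)
              (proj_dir theta @` four_corner d) = 0%E}]).
Proof.
split; first exact: P_delta_unique_root.
move=> delta delta_bounds delta_root d dd d6.
have delta_gt := root_P_delta_gt delta_bounds delta_root.
have d0 : 0 < d by lra.
have Pd : P_delta.[d] < 0.
  by rewrite -(rootP delta_root); apply: P_delta_decr => //; lra.
rewrite P_deltaE in Pd.
have [|e e0|l1 [l2 [l10 [l12 good]]]] := good_slopes_gt_delta _ _ Pd.
- by apply/andP; split; lra.
- by apply: (@exprn_small R d e) => //; apply/andP; split; lra.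
have al1 : 0 <= atan l1 by rewrite -atan0 le_atan.
have al2 := atan_ltpi2 l2.
have l12' := lt_atan l12.
have pi0 := pi_gt0 R.
(* These are the directions [theta] for which [tan (theta - pi / 2)] is a good slope. *)
exists `]pi / 2 + atan l1, pi / 2 + atan l2[%classic; split.
- move=> theta /=; rewrite !in_itv/= => /andP[t1 t2].
  by apply/andP; split; lra.
- exact: measurable_itv.
- by rewrite lebesgue_measure_itv/= lte_fin ltrD2l l12' -EFinD lte_fin; lra.
apply: (@hausdorff_proj_corner_ae R d 3) => //.
move=> theta /=; rewrite in_itv/= => /andP[t1 t2] n.
pose phi := theta - pi / 2.
have phi_bounds : - (pi / 2) < phi < pi / 2 by apply/andP; split; rewrite /phi; lra.
have tanphi : atan (tan phi) = phi by rewrite tanK// in_itv.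
have l_bounds : l1 < tan phi < l2.
  rewrite !ltNge; apply/andP; split; apply/negP => /le_atan; rewrite tanphi /phi; lra.
have [win start] := good _ l_bounds.
have [u [w [uw suw]]] := expandable_overlaps n d0 d6 win start.
exists u, w; split => //.
have c0 : cos phi != 0 by rewrite gt_eqF// cos_gt0_pihalf.
under eq_bigr do rewrite !digit_proj_slice// -mulrBr -mulrA.
rewrite -mulr_sumr normrM (le_trans _ suw)// ler_piMl//.
by rewrite ler_norml cos_geN1 cos_le1.
Qed.
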